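(* Let $X,Y$ be normed linear spaces and let $\Sigma=(S,h,\phi)$ be a dynamical system with output, with $S\subseteq X$ and $h:S\to Y$. Let $\Omega\subseteq S$ be a non-empty set such that $\phi(t,\Omega)\subseteq\Omega$ for all $t\ge0$, $0\in\Omega$, $h(0)=0$ and $\phi(t,0)=0$ for all $t\ge0$. Suppose that there exist a continuous, positive definite function $\rho:\mathbb{R}_+\to\mathbb{R}_+$, functions $a,b\in K_\infty$ and functionals $V,W:\Omega\to\mathbb{R}_+$ such that $$a(\|h(x)\|_Y)\le W(x)\quad\text{for all }x\in\Omega,$$ $$V(\phi(t,x))\le V(x)-\int_0^t\rho(W(\phi(s,x)))\,ds\quad\text{for all }x\in\Omega,\ t\ge0,$$ $$a(\|h(x)\|_Y)\le V(x)\le b(\|x\|_X)\quad\text{for all }x\in\Omega.$$ Moreover, suppose that either for every $x\in\Omega$ the mapping $t\mapsto W(\phi(t,x))$ is quasi-uniformly continuous, or for every $x\in\Omega$ the mapping $t\mapsto-W(\phi(t,x))$ is quasi-uniformly continuous. Finally, suppose that either $\rho$ is non-decreasing or for every $x\in\Omega$ the mapping $t\mapsto W(\phi(t,x))$ is bounded. Then $\Sigma$ is Asymptotically Output Stable (AOS) on $\Omega$.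
   Context: $\mathbb{R}_+=[0,+\infty)$. $K_\infty$ is the class of strictly increasing continuous functions $a:\mathbb{R}_+\to\mathbb{R}_+$ with $a(0)=0$ and $\lim_{s\to+\infty}a(s)=+\infty$. A function $\rho:\mathbb{R}_+\to\mathbb{R}_+$ is positive definite if $\rho(0)=0$ and $\rho(s)>0$ for $s>0$. A function $g:\mathbb{R}_+\to\mathbb{R}$ is quasi-uniformly continuous if for every $\varepsilon>0$ there exists $\delta(\varepsilon)>0$ such that $g(t)-g(t_0)<\varepsilon$ for all $t\ge t_0\ge0$ with $t\le t_0+\delta(\varepsilon)$. (Any such function is Lebesgue measurable; integrals are Lebesgue integrals.) A (continuous-time, deterministic, autonomous) dynamical system with output is a triplet $\Sigma=(S,h,\phi)$ consisting of a non-empty set $S\subseteq X$ (state space), a mapping $h:S\to Y$ (output map) and a mapping $\phi:\mathbb{R}_+\times S\to S$ satisfying $\phi(0,x)=x$ for all $x\in S$ and $\phi(t,\phi(s,x))=\phi(t+s,x)$ for all $x\in S$ and $t,s\ge0$. (No continuity of $\phi$ or $h$ is part of this definition.) Write $y(t,x_0)=h(\phi(t,x_0))$ and $B_R=\{x\in X:\|x\|_X<R\}$. The system $\Sigma$ is: - Lagrange output stable on $\Omega$ if for every $R>0$ the set $\{\|y(t,x_0)\|_Y:x_0\in B_R\cap\Omega,\ t\ge0\}$ is bounded; - Lyapunov output stable on $\Omega$ if for every $\varepsilon>0$ there exists $\delta(\varepsilon)>0$ such that for all $x_0\in B_{\delta(\varepsilon)}\cap\Omega$ it holds that $\|y(t,x_0)\|_Y\le\varepsilon$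 for all $t\ge0$; - AOS on $\Omega$ if it is Lagrange and Lyapunov output stable on $\Omega$ and $\lim_{t\to+\infty}y(t,x_0)=0$ for all $x_0\in\Omega$. *)

(* Defs.v *)
(* MathComp-Analysis, over an arbitrary realType. *)
From HB Require Import structures.
From mathcomp Require Import all_boot all_order all_algebra.
From mathcomp Require Import all_classical all_reals all_analysis.
Set Implicit Arguments.
Unset Strict Implicit.
Unset Printing Implicit Defensive.
Import Order.TTheory GRing.Theory Num.Theory.
Import numFieldNormedType.Exports.
Local Open Scope classical_set_scope.
Local Open Scope ring_scope.

(* A map defined on a subset (on [0, +oo[ inside R, or on a subset of X) is
   encoded as a total function about which every hypothesis and every
   conclusion only concerns arguments in that subset. *)

(* Nonnegativity of [a] on [0, +oo[ follows from the first two conjuncts. *)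
Definition K_infty (R : realType) (a : R -> R) : Prop :=
  [/\ a 0 = 0,
      (forall s t : R, 0 <= s -> s < t -> a s < a t),
      {within `[0, +oo[, continuous a} &
      a s @[s --> +oo] --> +oo].

Definition positive_definite (R : realType) (rho : R -> R) : Prop :=
  rho 0 = 0 /\ (forall s : R, 0 < s -> 0 < rho s).

(* One-sided: only upward variation, forward in time, is controlled. *)
Definition quasi_uniformly_continuous (R : realType) (g : R -> R) : Prop :=
  forall eps : R, 0 < eps -> exists2 delta : R, 0 < delta &
    forall t0 t : R, 0 <= t0 -> t0 <= t -> t <= t0 + delta -> g t - g t0 < eps.

Record dynsys (R : realType) (X Y : normedModType R) := DynSys {
  state : set X;
  output : X -> Y;
  flow : R -> X -> X;
  state_nonempty : state !=set0;
  flow_state : forall (t : R) x, 0 <= t -> state x -> state (flow t x);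
  flow0 : forall x, state x -> flow 0 x = x;
  flowD : forall (t s : R) x, 0 <= t -> 0 <= s -> state x ->
    flow t (flow s x) = flow (t + s) x
}.

Definition output_traj (R : realType) (X Y : normedModType R)
    (Sigma : dynsys X Y) (t : R) (x0 : X) : Y :=
  output Sigma (flow Sigma t x0).

Definition lagrange_output_stable (R : realType) (X Y : normedModType R)
    (Sigma : dynsys X Y) (Omega : set X) : Prop :=
  forall r : R, 0 < r ->
    bounded_set [set z : R | exists x0 (t : R),
      [/\ `|x0| < r, Omega x0, 0 <= t & z = `|output_traj Sigma t x0| ] ].

Definition lyapunov_output_stable (R : realType) (X Y : normedModType R)
    (Sigma : dynsys X Y) (Omega : set X) : Prop :=
  forall eps : R, 0 < eps -> exists2 delta : R, 0 < delta &
    forall x0, `|x0| < delta -> Omega x0 ->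
      forall t : R, 0 <= t -> `|output_traj Sigma t x0| <= eps.

Definition AOS (R : realType) (X Y : normedModType R)
    (Sigma : dynsys X Y) (Omega : set X) : Prop :=
  [/\ lagrange_output_stable Sigma Omega,
      lyapunov_output_stable Sigma Omega &
      forall x0, Omega x0 -> output_traj Sigma t x0 @[t --> +oo] --> (0 : Y)].

(* Main.v *)
(* Along a trajectory V does not increase, so a|y(t)| <= V(x) <= b|x|, which
   gives both stability properties. For convergence it suffices that W tends to
   0 along the trajectory. If W exceeds 2 eps at arbitrarily late times, either
   form of quasi-uniform continuity yields arbitrarily late intervals of a fixed
   length d (ending, resp. starting, at such a time) on which W >= eps, hence
   rho(W) >= c > 0. Across each of them V drops by at least c d; this is
   impossible once V is within c d of its infimum over the trajectory. *)
Require Import Defs.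
From HB Require Import structures.
From mathcomp Require Import all_boot all_order all_algebra.
From mathcomp Require Import all_classical all_reals all_analysis.
From mathcomp Require Import lra.
Import Order.TTheory GRing.Theory Num.Theory.
Import numFieldNormedType.Exports.
Local Open Scope classical_set_scope.
Local Open Scope ring_scope.

(* The nonnegative integral is a supremum over the simple functions below the
   integrand, so the measurability hypotheses of ge0_le_integral can be dropped. *)
Lemma ge0_le_integral_nonmeasurable d (T : measurableType d) (R : realType)
    (mu : {measure set T -> \bar R}) (D : set T) (f1 f2 : T -> \bar R) :
  (forall x, D x -> (0 <= f1 x)%E) -> (forall x, D x -> (f1 x <= f2 x)%E) ->
  (\int[mu]_(x in D) f1 x <= \int[mu]_(x in D) f2 x)%E.
Proof.
move=> f1_ge0 f12; rewrite !ge0_integralE//; last first.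
  by move=> x Dx; exact: le_trans (f1_ge0 _ Dx) (f12 _ Dx).
apply: le_ereal_sup => _ [h /= hf1 <-]; exists h => //= x.
apply: le_trans (hf1 x) _; rewrite /patch.
by case: ifPn => // /set_mem; exact: f12.
Qed.

Section K_infty_theory.
Context {R : realType} {a : R -> R}.
Hypothesis a_Kinfty : K_infty a.

(** Strict monotonicity lets inequalities be pulled back through [a], so the stability estimates
    construct no inverse function. *)
Lemma K_infty_le (s t : R) : 0 <= s -> 0 <= t -> (a s <= a t) = (s <= t).
Proof.
have [_ a_incr _ _] := a_Kinfty => s_ge0 t_ge0.
have [st|ts|->] := ltgtP s t; last exact: lexx.
- by rewrite ltW// a_incr.
- by apply: lt_geF; exact: a_incr.
Qed.

Lemma K_infty_gt0 (s : R) : 0 < s -> 0 < a s.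
Proof. by case: a_Kinfty => a0 a_incr _ _ s_gt0; rewrite -a0 a_incr. Qed.

(** Continuity within [[0, +oo[] gives right-continuity at 0, where [a] vanishes. *)
Lemma K_infty_small (eps : R) : 0 < eps -> exists2 delta, 0 < delta & a delta < eps.
Proof.
have [a0 a_incr a_cont _] := a_Kinfty => eps_gt0.
have [_ a_right] := (continuous_within_itvcyP _ _).1 a_cont.
have : \forall s \near 0^'+, a s < eps.
  by apply: (cvgr_lt (a 0)) => //; rewrite a0.
move=> small; near (0 : R)^'+ => s; exists s.
- by near: s; exact: nbhs_right_gt.
- by near: s.
Unshelve. all: by end_near. Qed.

Lemma K_infty_large (m : R) : exists2 s, 0 < s & m <= a s.
Proof.
have [_ _ _ /cvgryPge/(_ m) a_lim] := a_Kinfty.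
by have [s s_gt0 ms] := pinfty_ex_gt (real0 R) a_lim; exists s.
Qed.

End K_infty_theory.

(** If [g] cannot rise fast, a large value at [t] forces large values just before it, and the window
    starts at [t - delta]; if [g] cannot fall fast, it forces them just after, and the window starts
    at [t]. The condition [delta <= t] keeps the window in nonnegative time. *)
Lemma quasi_uniformly_continuous_plateau (R : realType) (g : R -> R) (eps : R) :
  quasi_uniformly_continuous g \/ quasi_uniformly_continuous (fun t => - g t) ->
  0 < eps ->
  exists2 delta, 0 < delta & forall t, delta <= t -> 2 * eps <= g t ->
    exists2 u, t - delta <= u & forall s, 0 <= s <= delta -> eps <= g (u + s).
Proof.
move=> [] gquc eps_gt0; have [delta delta_gt0 gdelta] := gquc _ eps_gt0;
  exists delta => // t t_ge gt.
- exists (t - delta) => // s /andP[s_ge0 s_le].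
  by have := gdelta (t - delta + s) t; lra.
- exists t; first lra.
  by move=> s /andP[s_ge0 s_le]; have := gdelta t (t + s); lra.
Qed.

(** The minimum over a compact interval away from 0 is attained, hence positive. The upper end [m]
    matters because [rho] may tend to 0 at infinity. *)
Lemma positive_definite_bounded_below (R : realType) (rho : R -> R) (l m : R) :
  {within `[0, +oo[, continuous rho} -> positive_definite rho -> 0 < l ->
  exists2 c, 0 < c & forall s, l <= s <= m -> c <= rho s.
Proof.
move=> rho_cont [_ rho_gt0] l_gt0.
have [lm|ml] := leP l m; last first.
  by exists 1 => // s; lra.
have [|s0 s0lm rho_min] := EVT_min lm (f := rho).
  apply: continuous_subspaceW rho_cont => s /=; rewrite !in_itv/= andbT.
  by case/andP => ls _; exact: le_trans (ltW l_gt0) ls.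
exists (rho s0); first by apply: rho_gt0; move: s0lm; rewrite in_itv/=; lra.
by move=> s lsm; apply: rho_min; rewrite in_itv.
Qed.

Section dissipation.
Context {R : realType} {v q : R -> R}.
Hypothesis v_ge0 : forall t, 0 <= t -> 0 <= v t.
Hypothesis q_ge0 : forall t, 0 <= t -> 0 <= q t.
Hypothesis v_decrease : forall t d, 0 <= t -> 0 <= d ->
  ((v (t + d))%:E <=
   (v t)%:E - \int[lebesgue_measure]_(s in `[0%R, d]) (q (t + s))%:E)%E.

(** Here [v] stands for V along a trajectory and [q] for rho(W). The loss [c * d] is the integral of
    the constant [c], which lies below [q] on the window. *)
Lemma dissipation_drop (t d c : R) : 0 <= t -> 0 <= d -> 0 <= c ->
  (forall s, 0 <= s <= d -> c <= q (t + s)) -> v (t + d) <= v t - c * d.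
Proof.
move=> t_ge0 d_ge0 c_ge0 q_ge.
rewrite -lee_fin EFinB; apply: le_trans (v_decrease _ _ t_ge0 d_ge0) _.
apply: leeB => //.
have -> : (c * d)%:E =
    (\int[@lebesgue_measure R]_(s in `[0%R, d]) (cst c%:E s))%E.
  rewrite integral_cst//= lebesgue_measure_itv/= lte_fin.
  have [d_gt0|d_le0] := ltP 0 d; first by rewrite sube0 EFinM.
  have -> : d = 0 by apply/eqP; rewrite eq_le d_le0.
  by rewrite mulr0 mule0.
apply: ge0_le_integral_nonmeasurable => s /=; first by rewrite lee_fin.
by rewrite in_itv/= lee_fin; exact: q_ge.
Qed.

Lemma dissipation_nonincreasing (t t' : R) : 0 <= t -> t <= t' -> v t' <= v t.
Proof.
(* Monotonicity is the drop estimate with [c = 0]. *)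
move=> t_ge0 tt'; have := @dissipation_drop t (t' - t) 0 t_ge0.
rewrite subrKC mul0r subr0 subr_ge0; apply=> // s /andP[s_ge0 _].
by apply: q_ge0; exact: addr_ge0.
Qed.

Lemma dissipation_no_plateau (d c : R) : 0 < d -> 0 < c ->
  exists2 T, 0 <= T &
    forall t, T <= t -> ~ (forall s, 0 <= s <= d -> c <= q (t + s)).
Proof.
move=> d_gt0 c_gt0; pose E := v @` [set t | 0 <= t].
have E_lb : has_lbound E by exists 0 => _ [t t_ge0 <-]; exact: v_ge0.
have E_inf : has_inf E by split=> //; exists (v 0), 0 => //=.
(* [T] satisfies [v T < inf E + c * d], so a drop of [c * d] after [T] would take [v] below its
   infimum. *)
have [_ [T T_ge0 <-] vT] := inf_adherent (mulr_gt0 c_gt0 d_gt0) E_inf.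
exists T => // t Tt q_ge; have t_ge0 := le_trans T_ge0 Tt.
have vtd : inf E <= v (t + d).
  by apply: ge_inf => //; exists (t + d) => //=; rewrite addr_ge0// ltW.
have := dissipation_drop _ _ _ t_ge0 (ltW d_gt0) (ltW c_gt0) q_ge.
by have := dissipation_nonincreasing _ _ T_ge0 Tt; lra.
Qed.

End dissipation.

(* A variant of Barbalat's lemma. *)
Lemma quasi_uniformly_continuous_cvg0 (R : realType) (v g rho : R -> R) :
  quasi_uniformly_continuous g \/ quasi_uniformly_continuous (fun t => - g t) ->
  (forall t, 0 <= t -> 0 <= v t) -> (forall t, 0 <= t -> 0 <= g t) ->
  (forall s, 0 <= s -> 0 <= rho s) ->
  (forall l, 0 < l ->
    exists2 c, 0 < c & forall t, 0 <= t -> l <= g t -> c <= rho (g t)) ->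
  (forall t d, 0 <= t -> 0 <= d ->
    ((v (t + d))%:E <=
     (v t)%:E - \int[lebesgue_measure]_(s in `[0%R, d]) (rho (g (t + s)))%:E)%E) ->
  g t @[t --> +oo] --> 0.
Proof.
move=> gquc v_ge0 g_ge0 rho_ge0 rho_lb v_decrease.
apply/cvgr0Pnorm_lt => eps eps_gt0.
have eps2_gt0 : 0 < eps / 2 by lra.
have [d d_gt0 plateau] := quasi_uniformly_continuous_plateau _ _ _ gquc eps2_gt0.
have [c c_gt0 rho_ge] := rho_lb _ eps2_gt0.
have [|T T_ge0 no_plateau] :=
  dissipation_no_plateau (q := rho \o g) v_ge0 _ v_decrease _ _ d_gt0 c_gt0.
  by move=> t t_ge0; apply: rho_ge0; exact: g_ge0.
(* The extra [d] ensures that the window, which starts at some [u >= t - d], starts after [T]. *)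
exists (T + d); split; first exact: num_real.
move=> t Tdt; rewrite ger0_norm; last by apply: g_ge0; lra.
rewrite ltNge; apply/negP => gt.
have [||u u_ge gu] := plateau t; [lra|lra|].
apply: (no_plateau u); first lra.
move=> s sd; apply: rho_ge; last exact: gu.
by case/andP: sd => s_ge0 _; apply: addr_ge0 => //; lra.
Qed.

Theorem theorem5 (R : realType) (X Y : normedModType R) (Sigma : dynsys X Y)
    (Omega : set X)
    (Omega_state : Omega `<=` state Sigma)
    (Omega_nonempty : Omega !=set0)
    (Omega_invariant : forall (t : R) x, 0 <= t -> Omega x -> Omega (flow Sigma t x))
    (Omega0 : Omega 0)
    (output0 : output Sigma 0 = 0)
    (flow_eq0 : forall t : R, 0 <= t -> flow Sigma t 0 = 0)
    (rho a b : R -> R) (V W : X -> R)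
    (rho_continuous : {within `[0, +oo[, continuous rho})
    (rho_posdef : positive_definite rho)
    (a_Kinfty : K_infty a)
    (b_Kinfty : K_infty b)
    (V_ge0 : forall x, Omega x -> 0 <= V x)
    (W_ge0 : forall x, Omega x -> 0 <= W x)
    (a_le_W : forall x, Omega x -> a `|output Sigma x| <= W x)
    (V_decrease : forall x (t : R), Omega x -> 0 <= t ->
      ((V (flow Sigma t x))%:E <=
       (V x)%:E - \int[lebesgue_measure]_(s in `[0%R, t])
                    (rho (W (flow Sigma s x)))%:E)%E)
    (V_bounds : forall x, Omega x ->
      a `|output Sigma x| <= V x /\ V x <= b `|x|)
    (W_quc :
      (forall x, Omega x ->
        quasi_uniformly_continuous (fun t => W (flow Sigma t x))) \/
      (forall x, Omega x ->
        quasi_uniformly_continuous (fun t => - W (flow Sigma t x))))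
    (rho_or_W :
      (forall s t : R, 0 <= s -> s <= t -> rho s <= rho t) \/
      (forall x, Omega x ->
        [bounded W (flow Sigma t x) | t in [set t : R | 0 <= t]])) :
  AOS Sigma Omega.
Proof.
have rho_ge0 s : 0 <= s -> 0 <= rho s.
  have [rho0 rho_gt0] := rho_posdef.
  by rewrite le_eqVlt => /predU1P[<-|/rho_gt0/ltW]; rewrite ?rho0.
(* The semigroup law and the invariance of [Omega] allow the decrease condition to be restarted at
   any time [t]. *)
have V_decreaseD x t d : Omega x -> 0 <= t -> 0 <= d ->
    ((V (flow Sigma (t + d) x))%:E <= (V (flow Sigma t x))%:E -
      \int[lebesgue_measure]_(s in `[0%R, d]) (rho (W (flow Sigma (t + s) x)))%:E)%E.
  move=> Ox t_ge0 d_ge0; have Sx := Omega_state _ Ox.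
  have := V_decrease _ d (Omega_invariant _ _ t_ge0 Ox) d_ge0.
  rewrite flowD// [d + t]addrC; congr (_ <= _ - _)%E.
  apply: eq_integral => s; rewrite inE/= in_itv/= => /andP[s_ge0 _].
  by rewrite flowD// [s + t]addrC.
have V_flow_ge0 x : Omega x -> forall t, 0 <= t -> 0 <= V (flow Sigma t x).
  by move=> Ox t t_ge0; apply: V_ge0; exact: Omega_invariant.
have W_flow_ge0 x : Omega x -> forall t, 0 <= t -> 0 <= W (flow Sigma t x).
  by move=> Ox t t_ge0; apply: W_ge0; exact: Omega_invariant.
have output_le x t : Omega x -> 0 <= t -> a `|output_traj Sigma t x| <= b `|x|.
  move=> Ox t_ge0; apply: le_trans (V_bounds _ Ox).2.
  apply: le_trans (V_bounds _ (Omega_invariant _ _ t_ge0 Ox)).1 _.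
  rewrite -[X in _ <= V X](flow0 (Omega_state _ Ox)).
  apply: (dissipation_nonincreasing (v := fun t => V (flow Sigma t x))
    (q := fun t => rho (W (flow Sigma t x)))) => //.
  - by move=> s s_ge0; apply: rho_ge0; exact: W_flow_ge0.
  - by move=> s d; exact: V_decreaseD.
split.
(* The output bound is [m]: a|y| <= b|x| <= b r <= a m. *)
- move=> r r_gt0; have [m m_gt0 brm] := K_infty_large a_Kinfty (b r).
  exists m; split; first exact: num_real.
  move=> M mM _ [x [t [xr Ox t_ge0 ->]]] /=.
  apply: le_trans (ltW mM); rewrite normr_id.
  rewrite -(K_infty_le a_Kinfty) ?normr_ge0 ?(ltW m_gt0)//.
  apply: le_trans (output_le _ _ Ox t_ge0) (le_trans _ brm).
  by rewrite (K_infty_le b_Kinfty) ?normr_ge0// ltW.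
- move=> eps eps_gt0.
  (* The radius [d] is chosen so that a|y| <= b|x| <= b d < a eps. *)
  have [d d_gt0 bd] := K_infty_small b_Kinfty _ (K_infty_gt0 a_Kinfty _ eps_gt0).
  exists d => // x xd Ox t t_ge0.
  rewrite -(K_infty_le a_Kinfty) ?normr_ge0 ?(ltW eps_gt0)//.
  apply: le_trans (output_le _ _ Ox t_ge0) (le_trans _ (ltW bd)).
  by rewrite (K_infty_le b_Kinfty) ?normr_ge0 ?(ltW d_gt0)// ltW.
move=> x Ox.
have W_cvg0 : W (flow Sigma t x) @[t --> +oo] --> 0.
  apply: (quasi_uniformly_continuous_cvg0 _ (fun t => V (flow Sigma t x))
    (fun t => W (flow Sigma t x)) rho).
  - by case: W_quc => Wquc; [left|right]; exact: Wquc.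
  - exact: V_flow_ge0.
  - exact: W_flow_ge0.
  - exact: rho_ge0.
  (* Where W >= l, the lower bound for rho(W) is [rho l] if [rho] is monotone, and otherwise the
     minimum of [rho] between [l] and a bound [m] of W along this trajectory. *)
  - case: rho_or_W => [rho_incr|W_bounded] l l_gt0.
      exists (rho l); first exact: rho_posdef.2.
      by move=> t _ lW; apply: rho_incr => //; exact: ltW.
    have [m _ Wm] := pinfty_ex_gt (real0 R) (W_bounded x Ox).
    have [c c_gt0 rho_c] :=
      positive_definite_bounded_below _ _ _ m rho_continuous rho_posdef l_gt0.
    exists c => // t t_ge0 lW; apply: rho_c; rewrite lW.
    by apply: le_trans (Wm t t_ge0); exact: ler_norm.
  - by move=> t d; exact: V_decreaseD.
apply/cvgr0Pnorm_lt => eps eps_gt0.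
(* Convergence of W is used at the threshold [a eps]: eventually a|y| <= W < a eps, hence |y| <
   eps. *)
have /cvgr0Pnorm_lt/(_ _ (K_infty_gt0 a_Kinfty _ eps_gt0)) W_lt := W_cvg0.
near=> t.
have t_ge0 : 0 <= t by near: t; exact: nbhs_pinfty_ge.
rewrite ltNge -(K_infty_le a_Kinfty) ?normr_ge0 ?(ltW eps_gt0)// -ltNge.
apply: le_lt_trans (a_le_W _ (Omega_invariant _ _ t_ge0 Ox)) _.
apply: le_lt_trans (ler_norm _) _.
by near: t.
Unshelve. all: by end_near. Qed.
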